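(* Let $G$ be a group belonging to the class $\mathcal{C}$ and let $H$ be a finite group. If $G$ and $H$ act on each other compatibly, then the non-abelian tensor product $G\otimes H$ is finite.
   Context: A group $G$ belongs to the class $\mathcal{C}$ if there is an extension of groups of one of the forms $1\to Q\to G\to F\to 1$ or $1\to F\to G\to Q\to 1$, where $Q$ is a finite group and $F$ is a finitely generated non-abelian free group. Groups act on themselves by conjugation on the left: ${}^{g}g'=gg'g^{-1}$. Let $G$ act on $H$ and $H$ act on $G$ by automorphisms (left actions, written ${}^{g}h$ and ${}^{h}g$). The mutual actions are compatible if ${}^{({}^{h}g)}h'={}^{hgh^{-1}}h'$ and ${}^{({}^{g}h)}g'={}^{ghg^{-1}}g'$ for all $g,g'\in G$, $h,h'\in H$, where ${}^{hgh^{-1}}h'$ means $h\cdot {}^{g}(h^{-1}h'h)\cdot h^{-1}$ and ${}^{ghg^{-1}}g'$ means $g\cdot {}^{h}(g^{-1}g'g)\cdot g^{-1}$. For compatible actions, the non-abelian tensor product $G\otimes H$ is the group generated by symbols $g\otimes h$ ($g\in G$, $h\in H$) with relations $gg'\otimes h=({}^{g}g'\otimes {}^{g}h)(g\otimes h)$ and $g\otimes hh'=(g\otimes h)({}^{h}g\otimes {}^{h}h')$ for all $g,g'\in G$, $h,h'\in H$. *)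

(* Defs.v *)
From HB Require Import structures.
From mathcomp Require Import all_boot fingroup.
From mathcomp Require Import boolp classical_sets cardinality.

Set Implicit Arguments.
Unset Strict Implicit.
Unset Printing Implicit Defensive.

Local Open Scope classical_set_scope.
Local Open Scope quotient_scope.
Local Open Scope group_scope.

(* The letter (x, false) stands for x and (x, true) for its inverse. *)
Definition word (X : Type) := seq (X * bool).

Definition letter (X : Type) (x : X) : word X := [:: (x, false)].

Definition word_inv (X : Type) (w : word X) : word X :=
  rev [seq (p.1, ~~ p.2) | p <- w].

(* R u v is read as the defining relation u = v. *)
Inductive word_eq (X : Type) (R : word X -> word X -> Prop) :
    word X -> word X -> Prop :=
| word_eq_rel u v : R u v -> word_eq R u v
| word_eq_cancel x b : word_eq R [:: (x, b); (x, ~~ b)] [::]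
| word_eq_cat u u' v v' :
    word_eq R u v -> word_eq R u' v' -> word_eq R (u ++ u') (v ++ v')
| word_eq_refl u : word_eq R u u
| word_eq_sym u v : word_eq R u v -> word_eq R v u
| word_eq_trans u v w : word_eq R u v -> word_eq R v w -> word_eq R u w.

Section Presented.
Variables (X : choiceType) (R : word X -> word X -> Prop).

Definition word_eqb : rel (word X) := fun u v => `[< word_eq R u v >].

Fact word_eqb_refl : reflexive word_eqb.
Proof. by move=> u; apply/asboolP; exact: word_eq_refl. Qed.

Fact word_eqb_sym : symmetric word_eqb.
Proof. by move=> u v; apply/asboolP/asboolP; exact: word_eq_sym. Qed.

Fact word_eqb_trans : transitive word_eqb.
Proof.
by move=> v u w /asboolP uv /asboolP vw; apply/asboolP; exact: word_eq_trans vw.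
Qed.

Canonical word_equiv :=
  EquivRel word_eqb word_eqb_refl word_eqb_sym word_eqb_trans.

(* The group with generators X and defining relations R. *)
Definition presented : Type := {eq_quot word_equiv}.

HB.instance Definition _ := Choice.copy presented {eq_quot word_equiv}.

Definition presented_pi (w : word X) : presented := \pi_({eq_quot word_equiv}) w.

Definition presented_repr (a : presented) : word X :=
  generic_quotient.repr (a : {eq_quot word_equiv}).

Definition presented_one : presented := presented_pi [::].

Definition presented_mul (a b : presented) : presented :=
  presented_pi (presented_repr a ++ presented_repr b).

Definition presented_inv (a : presented) : presented :=
  presented_pi (word_inv (presented_repr a)).

Lemma presented_piP (u v : word X) :
  presented_pi u = presented_pi v <-> word_eq R u v.
Proof.
split=> [/eqmodP /asboolP //|uv]; by apply/eqmodP/asboolP.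
Qed.

Lemma presented_reprK : cancel presented_repr presented_pi.
Proof. by move=> a; exact: (@reprK _ {eq_quot word_equiv}). Qed.

Lemma presented_reprP (w : word X) :
  word_eq R (presented_repr (presented_pi w)) w.
Proof. by apply/presented_piP; rewrite presented_reprK. Qed.

Lemma presented_piM (u v : word X) :
  presented_mul (presented_pi u) (presented_pi v) = presented_pi (u ++ v).
Proof. by apply/presented_piP/word_eq_cat; exact: presented_reprP. Qed.

Lemma word_mulVw (w : word X) : word_eq R (word_inv w ++ w) [::].
Proof.
elim: w => [|[x b] w IHw]; first exact: word_eq_refl.
rewrite /word_inv map_cons rev_cons cat_rcons -cat1s -(cat1s (x, b) w).
rewrite [X in _ ++ X]catA -/(word_inv w).
apply: word_eq_trans IHw; apply: word_eq_cat; first exact: word_eq_refl.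
rewrite -[X in word_eq R _ X]cat0s; apply: word_eq_cat; last exact: word_eq_refl.
by have := word_eq_cancel R x (~~ b); rewrite negbK.
Qed.

Fact presented_mulA : associative presented_mul.
Proof.
move=> a b c.
rewrite -(presented_reprK a) -(presented_reprK b) -(presented_reprK c).
by rewrite !presented_piM catA.
Qed.

Fact presented_mul1 : left_id presented_one presented_mul.
Proof. by move=> a; rewrite -(presented_reprK a) presented_piM. Qed.

Fact presented_mulr1 : right_id presented_one presented_mul.
Proof. by move=> a; rewrite -(presented_reprK a) presented_piM cats0. Qed.

Fact presented_mulV : left_inverse presented_one presented_inv presented_mul.
Proof.
move=> a; rewrite -{2}(presented_reprK a) presented_piM.
exact/presented_piP/word_mulVw.
Qed.

Fact presented_mulrV : right_inverse presented_one presented_inv presented_mul.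
Proof.
move=> a; rewrite -[LHS]presented_mul1.
rewrite -{1}(presented_mulV (presented_inv a)) -presented_mulA.
by rewrite [X in presented_mul _ X]presented_mulA presented_mulV
           presented_mul1 presented_mulV.
Qed.

HB.instance Definition _ := isGroup.Build presented
  presented_mulA presented_mul1 presented_mulr1 presented_mulV presented_mulrV.

Definition presented_gen (x : X) : presented := presented_pi (letter x).

Section UniversalProperty.
Variables (K : groupType) (f : X -> K).

Definition word_val (w : word X) : K :=
  \prod_(p <- w) (if p.2 then (f p.1)^-1 else f p.1).

Hypothesis f_rel : forall u v, R u v -> word_val u = word_val v.

Lemma word_val_eq (u v : word X) : word_eq R u v -> word_val u = word_val v.
Proof.
elim=> {u v} [u v /f_rel //|x b|u u' v v' _ IHu _ IHv|//|u v _ ->//|].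
- rewrite /word_val !big_cons big_nil /= mulg1.
  by case: b; rewrite /= ?mulVg ?mulgV.
- by rewrite /word_val !big_cat -!/(word_val _) IHu IHv.
- by move=> u v w _ -> _ ->.
Qed.

Definition presented_lift (a : presented) : K := word_val (presented_repr a).

Lemma presented_lift_pi (w : word X) :
  presented_lift (presented_pi w) = word_val w.
Proof. exact/word_val_eq/presented_reprP. Qed.

Fact presented_lift_morph : {morph presented_lift : a b / a * b}.
Proof.
move=> a b; rewrite -{1}(presented_reprK a) -{1}(presented_reprK b).
by rewrite [_ * _]presented_piM presented_lift_pi /word_val big_cat.
Qed.

Lemma presented_universal :
  exists phi : {multiplicative presented -> K},
    (forall x, phi (presented_gen x) = f x) /\
    forall psi : {multiplicative presented -> K},
      (forall x, psi (presented_gen x) = f x) -> psi =1 phi.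
Proof.
pose lift_mixin := isMultiplicative.Build _ _ _ presented_lift_morph.
pose phi : {multiplicative presented -> K} := HB.pack presented_lift lift_mixin.
exists phi; split=> [x|psi psi_gen a].
  by rewrite /= presented_lift_pi /word_val big_seq1.
have psiM u v : psi (presented_pi (u ++ v)) =
                psi (presented_pi u) * psi (presented_pi v).
  by rewrite -gmulfM [_ * _]presented_piM.
have psi1 : psi (presented_pi [::]) = 1.
  by apply: (@mulgI _ (psi (presented_pi [::]))); rewrite -psiM mulg1.
rewrite -(presented_reprK a) /= presented_lift_pi.
elim: (presented_repr a) => [|[x b] w IHw]; first by rewrite /word_val big_nil.
rewrite -cat1s psiM IHw /word_val big_cons; congr (_ * _).
case: b => /=; last exact: psi_gen.
apply: (@mulIg _ (f x)); rewrite mulVg -psi_gen -psiM -psi1; congr (psi _).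
exact/presented_piP/word_eq_cancel.
Qed.

End UniversalProperty.

End Presented.

Definition free_group (X : choiceType) : groupType :=
  presented (fun _ _ : word X => False).

Definition is_free (F : groupType) : Prop :=
  exists (X : choiceType) (f : {multiplicative free_group X -> F}), bijective f.

Definition finitely_generated (G : groupType) : Prop :=
  exists s : seq G, forall S : {pred G},
    group_closed S -> {subset s <= S} -> forall g, g \in S.

Definition abelian_group (G : groupType) : Prop := forall x y : G, x * y = y * x.

(* There is a short exact sequence 1 -> N -> G -> Q -> 1. *)
Definition is_extension (N G Q : groupType) : Prop :=
  exists (i : {multiplicative N -> G}) (p : {multiplicative G -> Q}),
    [/\ injective i, range i = p @^-1` [set 1] & range p = [set: Q]].

Definition class_C (G : groupType) : Prop :=
  exists (Q : finGroupType) (F : groupType),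
    [/\ is_free F, finitely_generated F & ~ abelian_group F] /\
    (is_extension Q G F \/ is_extension F G Q).

Definition left_action_by_automorphisms (A B : groupType) (act : A -> B -> B) :
    Prop :=
  [/\ forall b, act 1 b = b,
      forall a a' b, act (a * a') b = act a (act a' b) &
      forall a b b', act a (b * b') = act a b * act a b'].

Section Tensor.
Variables (G H : groupType) (actG : G -> H -> H) (actH : H -> G -> G).

Definition compatible_actions : Prop :=
  (forall (g : G) (h h' : H),
     actG (actH h g) h' = h * actG g (h^-1 * h' * h) * h^-1) /\
  (forall (g g' : G) (h : H),
     actH (actG g h) g' = g * actH h (g^-1 * g' * g) * g^-1).

(* The action of G on itself, and of H on itself, is conjugation on the left. *)
Inductive tensor_rel : word (G * H) -> word (G * H) -> Prop :=
| tensor_rel_l g g' h :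
    tensor_rel (letter (g * g', h))
               (letter (g * g' * g^-1, actG g h) ++ letter (g, h))
| tensor_rel_r g h h' :
    tensor_rel (letter (g, h * h'))
               (letter (g, h) ++ letter (actH h g, h * h' * h^-1)).

Definition tensor : groupType := presented tensor_rel.

End Tensor.

(* Main.v *)
Require Import Defs.
From HB Require Import structures.
From mathcomp Require Import all_boot fingroup cyclic.
From mathcomp Require Import boolp classical_sets cardinality.

(** Only two properties of a group [G] in the class C matter: it is finitely
    generated, and its centre is finite. Both pass through the two kinds of
    extension; the second rests on the triviality of the centre of a
    non-abelian free group, which is seen on reduced words
    ([free_group_center_trivial]).

    Let [T] be the tensor product. It carries actions of [G] and [H] and
    homomorphisms [lambda : T -> G] and [mu : T -> H] with
    [lambda (g \ox h) = g * (actH h g)^-1] and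
    [mu (g \ox h) = actG g h * h^-1]. Expanding one symbol in two ways gives
    two pairs of formulas:
    - [t * u * t^-1] is the image of [u] under [mu t], and also under
      [lambda t];
    - [y \ox mu t = (y . t) * t^-1] and [lambda t \ox h = t * (h . t)^-1].

    By the second pair of formulas [G] fixes the kernel of [mu], so [lambda]
    sends this kernel into the centre of [G]. As [mu] has a finite target, the
    image of [lambda] is finite ([finite_range_lambda]). The same formulas show
    that [T] is generated by the [x \ox h] with [x] in a finite generating set
    of [G] ([generates_tensor]).

    To see torsion, pass to the semidirect product [E] of [T] by [H]. The
    relation for [g \ox (h * h')] says exactly that
    [h |-> (g \ox h, h)] is a homomorphism, so the elements [(g \ox h, h)] and
    [(1, h)] have order dividing [#|H|]. Finitely many of them generate [E], and
    [semidirect_conj] expresses their conjugates by [(t, h)] in terms of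
    [mu t], [lambda t] and [h], each of which takes finitely many values.
    Dietzmann's lemma ([finite_dietzmann]) then says that [E], and with it [T],
    is finite. *)

Set Implicit Arguments.
Unset Strict Implicit.
Unset Printing Implicit Defensive.

Local Open Scope group_scope.
Local Open Scope classical_set_scope.

(** * Subgroups, generating sets and morphisms *)

Definition is_subgroup (K : groupType) (P : set K) : Prop :=
  [/\ P 1, forall x y, P x -> P y -> P (x * y) & forall x, P x -> P x^-1].

Definition generates (K : groupType) (A : set K) : Prop :=
  forall P : set K, is_subgroup P -> A `<=` P -> forall x, P x.

Definition center (K : groupType) : set K := [set c | forall x, commute c x].

Lemma finitely_generatedP (K : groupType) :
  finitely_generated K <-> exists2 A : set K, finite_set A & generates A.
Proof.
split=> [[s gen_s]|[A /finite_seqP[s ->] gen_s]].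
  exists [set` s]; first exact: finite_seq.
  move=> P [P1 PM PV] sP x; have: x \in [pred y | `[< P y >]].
    apply: gen_s => [|y /sP Py]; last exact/asboolP.
    split=> [|y z /asboolP Py /asboolP Pz]; apply/asboolP => //.
    exact/PM/PV.
  by move/asboolP.
exists s => S clS sS; apply: (gen_s [set x | x \in S]) => //.
split=> /= [|x y|x]; [exact: (fst clS)| |].
  exact: (group_closedM clS).
exact: (group_closedV clS).
Qed.

Section Morphism.
Variables (K L : groupType) (f : K -> L).
Hypothesis fM : {morph f : x y / x * y}.

Lemma morph_group1 : f 1 = 1.
Proof. by apply: (mulIg (f 1)); rewrite -fM !mul1g. Qed.

Lemma morph_groupV x : f x^-1 = (f x)^-1.
Proof. by apply/esym/mulg1_eq; rewrite -fM mulgV morph_group1. Qed.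

Lemma is_subgroup_preimage (P : set L) :
  is_subgroup P -> is_subgroup [set x | P (f x)].
Proof.
case=> P1 PM PV; split=> /= [|x y|x]; first by rewrite morph_group1.
  by rewrite fM; exact: PM.
by rewrite morph_groupV; exact: PV.
Qed.

Lemma is_subgroup_image (P : set K) : is_subgroup P -> is_subgroup (f @` P).
Proof.
case=> P1 PM PV; split=> [|_ _ [x Px <-] [y Py <-]|_ [x Px <-]].
- by exists 1 => //; exact: morph_group1.
- by exists (x * y); [exact: PM|].
- by exists x^-1; [exact: PV|exact: morph_groupV].
Qed.

End Morphism.

Lemma is_subgroup_commute (K : groupType) (x : K) :
  is_subgroup [set y | commute x y].
Proof.
split=> /= [|y z|y]; [exact: commute1|exact: commuteM|exact: commuteV].
Qed.

Lemma generates_eq_morph (K L : groupType) (A : set K) (f g : K -> L) :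
  generates A -> {morph f : x y / x * y} -> {morph g : x y / x * y} ->
  (forall x, A x -> f x = g x) -> forall x, f x = g x.
Proof.
move=> genA fM gM fg; apply: genA fg; split=> /= [|x y ex ey|x ex].
- by rewrite !morph_group1.
- by rewrite fM gM ex ey.
- by rewrite !morph_groupV // ex.
Qed.

(** Left-associated products with adjacent inverse pairs cancelled: rewriting
    with these rules to a normal form decides the identities that hold in every
    group. *)
Definition group_simpl (K : groupType) :=
  (@invgM K, @invgK K, @invg1 K, @mul1g K, @mulg1 K, @mulgA K,
   @mulgVK K, @mulgK K, @mulVg K, @mulgV K).

Section Action.
Variables (A B : groupType) (act : A -> B -> B).
Hypothesis act_aut : left_action_by_automorphisms act.

Lemma act1 b : act 1 b = b. Proof. by case: act_aut => ->. Qed.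

Lemma actM a a' b : act (a * a') b = act a (act a' b).
Proof. by case: act_aut => _ ->. Qed.

Lemma actD a : {morph act a : b b' / b * b'}.
Proof. by case: act_aut => _ _ actD b b'; exact: actD. Qed.

Lemma act_1 a : act a 1 = 1. Proof. exact: morph_group1 (actD a). Qed.

Lemma actV a b : act a b^-1 = (act a b)^-1.
Proof. exact: morph_groupV (actD a) b. Qed.

Lemma actK a : cancel (act a) (act a^-1).
Proof. by move=> b; rewrite -actM mulVg act1. Qed.

Lemma actVK a : cancel (act a^-1) (act a).
Proof. by move=> b; rewrite -actM mulgV act1. Qed.

End Action.

(** * Groups given by generators and relations *)

Section Presentation.
Variables (X : choiceType) (R : word X -> word X -> Prop).

Lemma presented_generates : generates (range (@presented_gen X R)).
Proof.
move=> P [P1 PM PV] gP a; rewrite -(presented_reprK a).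
elim: (presented_repr a) => [//|[x b] w IHw].
rewrite -cat1s -presented_piM; apply: PM => //.
have Px : P (presented_gen R x) by apply: gP; exists x.
case: b => //; rewrite (_ : presented_pi R _ = (presented_gen R x)^-1).
  exact: PV.
apply/esym/mulg1_eq; rewrite [_ * _]presented_piM.
exact/presented_piP/word_eq_cancel.
Qed.

Lemma presented_lift_gen (K : groupType) (f : X -> K)
    (f_rel : forall u v, R u v -> word_val f u = word_val f v) x :
  presented_lift f (presented_gen R x) = f x.
Proof. by rewrite presented_lift_pi // /word_val big_seq1. Qed.

End Presentation.

(** * The centre of a free group *)

Section FreeReduction.
Variable X : choiceType.
Implicit Types (p q : X * bool) (w s : word X).

Definition letter_inv p : X * bool := (p.1, ~~ p.2).

Definition no_cancel p q := q != letter_inv p.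

Definition push p s : word X :=
  if s is q :: s' then if no_cancel p q then p :: s else s' else [:: p].

Lemma letter_invK : involutive letter_inv.
Proof. by case=> x b; rewrite /letter_inv /= negbK. Qed.

Lemma push_reduced p s : sorted no_cancel s -> sorted no_cancel (push p s).
Proof.
case: s => [//|q s] red_s /=; case: ifP => [pq|_]; first by rewrite /= pq.
exact: path_sorted red_s.
Qed.

Lemma foldr_push_reduced w s :
  sorted no_cancel s -> sorted no_cancel (foldr push s w).
Proof. by move=> red_s; elim: w => //= p w; exact: push_reduced. Qed.

Lemma pushK p s : sorted no_cancel s -> push p (push (letter_inv p) s) = s.
Proof.
case: s => [|q s] /= red_s; first by rewrite /no_cancel eqxx.
case: ifP => [_|] /=; first by rewrite /no_cancel eqxx.
rewrite {1}/no_cancel letter_invK => /negbFE/eqP eq_qp.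
by case: s red_s => [|q' s] /=; rewrite eq_qp // => /andP[->].
Qed.

(** Letters act on reduced words by [push], and by [pushK] inverse letters act
    by inverse permutations: so the free group acts on reduced words. *)
Lemma foldr_push_eq w w' : word_eq (fun _ _ : word X => False) w w' ->
  forall s, sorted no_cancel s -> foldr push s w = foldr push s w'.
Proof.
elim=> {w w'} [//|x b s red_s|u u' v v' _ IHu _ IHv s red_s|//||].
- exact: (pushK (x, b) red_s).
- by rewrite !foldr_cat IHv // IHu //; exact: foldr_push_reduced.
- by move=> u v _ IH s red_s; rewrite IH.
- by move=> u v w _ IHu _ IHv s red_s; rewrite IHu // IHv.
Qed.

Lemma foldr_push_id w : sorted no_cancel w -> foldr push [::] w = w.
Proof.
elim: w => [//|p w IHw] /= red_w; rewrite IHw; last exact: path_sorted red_w.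
by case: w red_w {IHw} => [//|q w] /= /andP[->].
Qed.

Lemma word_eq_reduced w :
  word_eq (fun _ _ : word X => False) w (foldr push [::] w).
Proof.
elim: w => [|p w IHw] /=; first exact: word_eq_refl.
apply: word_eq_trans (_ : word_eq _ (p :: foldr push [::] w) _).
  by apply: (@word_eq_cat _ _ [:: p] w [:: p]) => //; exact: word_eq_refl.
case: (foldr push [::] w) => [|q s] /=; first exact: word_eq_refl.
case: ifP => [_|/negbFE/eqP->]; first exact: word_eq_refl.
apply: (@word_eq_cat _ _ [:: p; letter_inv p] s [::]); last exact: word_eq_refl.
by case: p => x b; exact: word_eq_cancel.
Qed.

Lemma reduced_inj w w' : sorted no_cancel w -> sorted no_cancel w' ->
  word_eq (fun _ _ : word X => False) w w' -> w = w'.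
Proof.
move=> red_w red_w' /foldr_push_eq/(_ [::] isT).
by rewrite !foldr_push_id.
Qed.

(** For a nonempty reduced word [w] whose first letter is on [x], and [y != x],
    choose the sign of the letter [p] on [y] so that the last letter of [w] is
    not its inverse: then [p w] and [w p] are distinct reduced words. If there
    is no such [y], the group is generated by [x] alone, hence abelian. *)
Lemma free_group_center_trivial (c : free_group X) :
  ~ abelian_group (free_group X) -> center c -> c = 1.
Proof.
move=> nonab cenc; set w0 := foldr push [::] (presented_repr c).
have def_c : c = presented_pi _ w0.
  by rewrite -[LHS]presented_reprK; exact/presented_piP/word_eq_reduced.
have: sorted no_cancel w0 by exact: foldr_push_reduced.
case: w0 def_c => [->//|[x a] w] def_c red_w; case: nonab.
have one_letter y : y = x.
  apply/eqP/negPn/negP => neq_yx.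
  pose b := (last (x, a) w == (y, true)); pose p := (y, b).
  have red_pw : sorted no_cancel (p :: (x, a) :: w).
    rewrite /= -/(sorted no_cancel ((x, a) :: w)) red_w andbT.
    rewrite /no_cancel /letter_inv /=.
    by apply: contra neq_yx => /eqP[->].
  have red_wp : sorted no_cancel (rcons ((x, a) :: w) p).
    rewrite /= rcons_path -/(sorted no_cancel ((x, a) :: w)) red_w /=.
    rewrite /no_cancel /letter_inv /p /b.
    case: (last (x, a) w) => z [] /=; rewrite !xpair_eqE /=.
      by rewrite andbT [y == z]eq_sym; case: (z == y).
    by rewrite andbF /= andbF.
  have /(reduced_inj red_pw red_wp)[eq_yx _] :
      word_eq (fun _ _ : word X => False) (p :: (x, a) :: w)
              (rcons ((x, a) :: w) p).
    apply/presented_piP; rewrite -cats1 -cat1s -!presented_piM -def_c.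
    exact/esym/cenc.
  by rewrite eq_yx eqxx in neq_yx.
have gen_comm (u v : free_group X) : commute (presented_gen _ x) v.
  apply: presented_generates (is_subgroup_commute _) _ v => _ [y _ <-].
  by rewrite (one_letter y); exact: commute_refl.
move=> u v.
apply: presented_generates (is_subgroup_commute _) _ v => _ [y _ <-].
by rewrite (one_letter y); exact/commute_sym/gen_comm.
Qed.

End FreeReduction.

Lemma is_free_center_trivial (F : groupType) (c : F) :
  is_free F -> ~ abelian_group F -> center c -> c = 1.
Proof.
move=> [X [f bij_f]] nonab cenc; case: (bij_f) => g fK gK.
have fM : {morph f : x y / x * y} by move=> x y; exact: gmulfM.
rewrite -(gK c) (_ : g c = 1) ?(morph_group1 fM) //.
apply: free_group_center_trivial => [ab|x].
  by apply: nonab => x y; rewrite -(gK x) -(gK y) -!fM ab.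
by apply: (can_inj fK); rewrite !fM gK; exact: cenc.
Qed.

(** * The class C *)

Lemma finitely_generated_fingroup (Q : finGroupType) : finitely_generated Q.
Proof.
apply/finitely_generatedP; exists [set: Q]; first exact: finite_finset.
by move=> P _ QP x; exact: QP.
Qed.

(** The generators of [G] are those of [N] and lifts of those of [Q]. *)
Lemma finitely_generated_extension (N G Q : groupType) :
  finitely_generated N -> finitely_generated Q -> is_extension N G Q ->
  finitely_generated G.
Proof.
move=> /finitely_generatedP[A finA genA] /finitely_generatedP[B finB genB].
move=> [i [p [_ ker_p surj_p]]].
have iM : {morph i : x y / x * y} by move=> x y; exact: gmulfM.
have pM : {morph p : x y / x * y} by move=> x y; exact: gmulfM.
have /choice[lift liftK] q : exists g, p g = q.
  by have [g _ <-] : range p q by [rewrite surj_p]; exists g.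
apply/finitely_generatedP; exists (i @` A `|` lift @` B).
  by rewrite finite_setU; split; exact: finite_image.
move=> P subP; rewrite subUset => -[AP BP] g; case: (subP) => P1 PM PV.
have Pi n : P (i n).
  apply: genA (is_subgroup_preimage iM subP) _ n => n An.
  by apply: AP; exists n.
have [g' Pg' pg'] : (p @` P) (p g).
  apply: genB (is_subgroup_image pM subP) _ (p g) => q Bq.
  by exists (lift q) => //; apply: BP; exists q.
have [n _ def_n] : range i (g * g'^-1).
  by rewrite ker_p /= pM morph_groupV // pg' mulgV.
by rewrite -(mulgVK g' g) -def_n; exact: PM.
Qed.

(** A central element of [G] has a central image in [Q], hence lies in [N]. *)
Lemma finite_center_extension_by_centerless
    (N : finGroupType) (G Q : groupType) :
  is_extension N G Q -> (forall q : Q, center q -> q = 1) ->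
  finite_set (@center G).
Proof.
move=> [i [p [_ ker_p surj_p]]] cenQ.
apply: sub_finite_set (finite_image i (@finite_finset N setT)).
move=> c cenc; rewrite ker_p /=; apply: cenQ => q.
have [g _ <-] : range p q by rewrite surj_p.
by rewrite /commute -!gmulfM cenc.
Qed.

(** The centre of [G] meets [N] in central elements of [N], so it embeds in
    [Q]. *)
Lemma finite_center_extension_of_centerless
    (N G : groupType) (Q : finGroupType) :
  is_extension N G Q -> (forall n : N, center n -> n = 1) ->
  finite_set (@center G).
Proof.
move=> [i [p [inj_i ker_p _]]] cenN.
have iM : {morph i : x y / x * y} by move=> x y; exact: gmulfM.
have pM : {morph p : x y / x * y} by move=> x y; exact: gmulfM.
rewrite -(eq_finite_set (@inj_card_eq _ _ (@center G) p _)).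
  exact: finite_finset.
move=> x y /set_mem cenx /set_mem ceny pxy; apply/divg1_eq.
have cenxy : center (x * y^-1).
  move=> g; apply: commute_sym; apply: commuteM; first exact/commute_sym/cenx.
  exact/commuteV/commute_sym/ceny.
have [n _ def_n] : range i (x * y^-1).
  by rewrite ker_p /= pM morph_groupV // pxy mulgV.
rewrite -def_n (cenN n) ?(morph_group1 iM) // => m.
by apply: inj_i; rewrite !iM def_n; exact: cenxy.
Qed.

Lemma class_C_finitely_generated (G : groupType) :
  class_C G -> finitely_generated G.
Proof.
move=> [Q [F [[_ fgF _] [ext|ext]]]];
  apply: finitely_generated_extension ext => //;
  exact: finitely_generated_fingroup.
Qed.

Lemma class_C_finite_center (G : groupType) :
  class_C G -> finite_set (@center G).
Proof.
move=> [Q [F [[freeF _ nonabF] ext]]].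
have cenF (c : F) : center c -> c = 1 by exact: is_free_center_trivial.
case: ext => ext; first exact: finite_center_extension_by_centerless ext cenF.
exact: finite_center_extension_of_centerless ext cenF.
Qed.

(** * Dietzmann's lemma *)

Lemma size_count_mem_bound (T : eqType) (s w : seq T) n :
  {subset w <= s} -> (forall x, x \in s -> count_mem x w <= n) ->
  size w <= size s * n.
Proof.
elim: s w => [|x s IHs] w ws cw.
  by case: w ws {cw} => // y w /(_ y); rewrite inE eqxx; move/(_ isT).
rewrite mulSn -(count_predC (pred1 x) w) leq_add ?cw ?inE ?eqxx //.
rewrite -size_filter; apply: IHs => [y|y sy].
  by rewrite mem_filter /= => /andP[neq_yx /ws]; rewrite inE (negPf neq_yx).
rewrite count_filter; apply: leq_trans (cw y _); last by rewrite inE sy orbT.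
by apply: sub_count => z /andP[].
Qed.

Section Dietzmann.
Variables (K : groupType) (A : set K) (n : nat).
Hypotheses (finA : finite_set A) (n_gt0 : 0 < n)
  (conjA : forall x y, A x -> A y -> A (x ^ y))
  (expA : forall x, A x -> x ^+ n = 1).

Let word_of (w : seq K) := forall x, x \in w -> A x.

(** Inverses are avoided in words by writing [x^-1] as [x ^+ n.-1]. *)
Lemma generates_words : generates A ->
  forall x, exists2 w : seq K, word_of w & x = \prod_(y <- w) y.
Proof.
move=> genA; apply: genA => [|x Ax]; last first.
  exists [:: x]; last by rewrite big_seq1.
  by move=> y; rewrite inE => /eqP->.
split=> /= [|_ _ [v Av ->] [w Aw ->]|_ [w Aw ->]].
- by exists [::]; rewrite ?big_nil.
- exists (v ++ w); last by rewrite big_cat.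
  by move=> x; rewrite mem_cat => /orP[/Av|/Aw].
elim: w Aw => [|x w IHw] Aw; first by exists [::]; rewrite ?big_nil ?invg1.
have [|v Av def_v] := IHw; first by move=> y wy; apply: Aw; rewrite inE wy orbT.
have Ax : A x by apply: Aw; rewrite inE eqxx.
exists (v ++ nseq n.-1 x).
  move=> y; rewrite mem_cat => /orP[/Av//|].
  by rewrite mem_nseq => /andP[_ /eqP->].
rewrite big_cons invgM def_v big_cat; congr (_ * _).
by apply: mulg1_eq; rewrite big_nseq iter_mulg_1 -expgS prednK // expA.
Qed.

(** Moving an occurrence of [x] to the front conjugates the letters it passes
    by [x], which fixes the other occurrences of [x]. *)
Lemma pull_letter x k (w : seq K) : A x -> word_of w -> k <= count_mem x w ->
  exists v, [/\ word_of v, size w = k + size v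
    & \prod_(y <- w) y = x ^+ k * \prod_(y <- v) y].
Proof.
move=> Ax.
have pull1 (u : seq K) : word_of u -> x \in u -> exists v, [/\ word_of v,
    size u = (size v).+1, count_mem x u = (count_mem x v).+1
    & \prod_(y <- u) y = x * \prod_(y <- v) y].
  elim: u => [//|z u IHu] Au; rewrite inE eq_sym.
  have Au' : word_of u by move=> y uy; apply: Au; rewrite inE uy orbT.
  case: eqVneq => [-> _|neq_zx /= ux].
    by exists u; rewrite /= eqxx big_cons.
  have [v [Av su cu pu]] := IHu Au' ux.
  exists (z ^ x :: v); split=> [y|||]; rewrite ?big_cons /= ?su ?cu ?pu //.
  - rewrite inE => /orP[/eqP->|/Av//]; apply: conjA => //.
    by apply: Au; rewrite inE eqxx.
  - rewrite (negPf neq_zx) (_ : z ^ x == x = false) //.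
    apply: contraNF neq_zx => /eqP zx.
    by rewrite -(inj_eq (can_inj (conjgK x))) zx conjgE mulKg.
  - by rewrite mulgA (conjgC z x) -mulgA.
elim: k w => [|k IHk] w Aw lt_k.
  by exists w; split=> //; rewrite expg0 mul1g.
have [|v [Av sw cw pw]] := pull1 w Aw.
  by rewrite -has_pred1 has_count; case: count lt_k.
have [|u [Au sv pv]] := IHk v Av; first by rewrite cw in lt_k.
by exists u; split; rewrite // ?sw ?sv // pw pv mulgA expgS.
Qed.

(** A word longer than [#|A| * n] contains some letter [n] times. Pulled to the
    front these occurrences cancel, so every element is the product of a word
    of bounded length. *)
Lemma finite_dietzmann : generates A -> finite_set [set: K].
Proof.
move=> genA; have /finite_seqP[s defA] := finA.
pose L := (size s * n)%N.
have short x : exists w : seq K,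
    [/\ word_of w, size w <= L & x = \prod_(y <- w) y].
  have [w Aw ->] := generates_words genA x.
  have [m] := ubnP (size w); elim: m w Aw => // m IHm w Aw lt_wm.
  have [le_wL|lt_Lw] := leqP (size w) L; first by exists w.
  have [x' sx' le_n] : exists2 y, y \in s & n <= count_mem y w.
    apply: contrapT => few; move: lt_Lw; rewrite ltnNge => /negP; apply.
    apply: size_count_mem_bound => [y /Aw|y sy]; first by rewrite defA.
    by apply: ltnW; rewrite ltnNge; apply/negP => le_n; apply: few; exists y.
  have Ax' : A x' by rewrite defA.
  have [v [Av sw ->]] := pull_letter Ax' Aw le_n.
  rewrite expA // mul1g; apply: IHm Av _.
  rewrite sw ltnS in lt_wm; apply: leq_trans lt_wm.
  by rewrite -[X in X < _]add0n ltn_add2r.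
pose prod_of (t : L.-bseq (seq_sub s)) := \prod_(y <- t) ssval y.
apply: sub_finite_set (finite_image prod_of (@finite_finset _ setT)).
move=> x _; have [w [Aw le_w ->]] := short x.
have /all_sigP[t def_w] : all (mem s) w by apply/allP => y /Aw; rewrite defA.
pose t' := [seq SeqSub (valP y) | y <- t].
have le_t : size t' <= L by rewrite size_map -(size_map sval) -def_w.
exists (Bseq le_t) => //.
by rewrite /prod_of /= big_map def_w big_map.
Qed.

End Dietzmann.

(** * The non-abelian tensor product *)

Section TensorProduct.
Variables (G H : groupType) (actG : G -> H -> H) (actH : H -> G -> G).
Hypotheses (actG_aut : left_action_by_automorphisms actG)
  (actH_aut : left_action_by_automorphisms actH)
  (compat : compatible_actions actG actH).

Local Notation T := (tensor actG actH).

Definition tensor_elt (g : G) (h : H) : T := presented_gen _ (g, h).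

Local Notation "g \ox h" := (tensor_elt g h) (at level 39).

Lemma tensorMl g g' h :
  (g * g') \ox h = (g * g' * g^-1) \ox actG g h * g \ox h.
Proof.
rewrite [RHS]presented_piM; apply/presented_piP/word_eq_rel.
exact: tensor_rel_l.
Qed.

Lemma tensorMr g h h' :
  g \ox (h * h') = g \ox h * actH h g \ox (h * h' * h^-1).
Proof.
rewrite [RHS]presented_piM; apply/presented_piP/word_eq_rel.
exact: tensor_rel_r.
Qed.

Lemma tensor_generates : generates [set t : T | exists g h, t = g \ox h].
Proof.
move=> P subP eltP; apply: presented_generates => // _ [[g h] _ <-].
by apply: eltP; exists g, h.
Qed.

Section Lift.
Variables (K : groupType) (f : G -> H -> K).
Hypotheses
  (fMl : forall g g' h, f (g * g') h = f (g * g' * g^-1) (actG g h) * f g h)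
  (fMr : forall g h h', f g (h * h') = f g h * f (actH h g) (h * h' * h^-1)).

Definition tensor_lift : T -> K := presented_lift (fun p => f p.1 p.2).

Lemma tensor_lift_rel u v : tensor_rel actG actH u v ->
  word_val (fun p => f p.1 p.2) u = word_val (fun p => f p.1 p.2) v.
Proof.
by case=> [g g' h|g h h']; rewrite /word_val big_cat !big_seq1 /= -?fMl -?fMr.
Qed.

Lemma tensor_liftM : {morph tensor_lift : t u / t * u}.
Proof. exact: presented_lift_morph tensor_lift_rel. Qed.

Lemma tensor_lift_elt g h : tensor_lift (g \ox h) = f g h.
Proof. exact: (presented_lift_gen tensor_lift_rel). Qed.

End Lift.

Lemma compat_conjG g h h' :
  actG (actH h g) (h * h' * h^-1) = h * actG g h' * h^-1.
Proof. by rewrite compat.1 !group_simpl. Qed.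

Lemma compat_conjH g g' h :
  actH (actG g h) (g * g' * g^-1) = g * actH h g' * g^-1.
Proof. by rewrite compat.2 !group_simpl. Qed.

(** [lambda] and [mu] below make [T] a crossed module over [G] and over [H], for
    the diagonal actions of [G] and [H]. *)
Definition tensor_lambda : T -> G := tensor_lift (fun g h => g * (actH h g)^-1).
Definition tensor_mu : T -> H := tensor_lift (fun g h => actG g h * h^-1).
Definition tensor_actG (x : G) : T -> T :=
  tensor_lift (fun g h => (x * g * x^-1) \ox actG x h).
Definition tensor_actH (y : H) : T -> T :=
  tensor_lift (fun g h => actH y g \ox (y * h * y^-1)).

Local Notation lambda := tensor_lambda.
Local Notation mu := tensor_mu.
Local Notation tG := tensor_actG.
Local Notation tH := tensor_actH.

Fact tensor_lambda_spec :
  {morph lambda : t u / t * u} /\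
  forall g h, lambda (g \ox h) = g * (actH h g)^-1.
Proof.
have fMl g g' h : g * g' * (actH h (g * g'))^-1 =
    g * g' * g^-1 * (actH (actG g h) (g * g' * g^-1))^-1 * (g * (actH h g)^-1).
  by rewrite compat_conjH (actD actH_aut) !group_simpl.
have fMr g h h' : g * (actH (h * h') g)^-1 =
    g * (actH h g)^-1 * (actH h g * (actH (h * h' * h^-1) (actH h g))^-1).
  by rewrite -(actM actH_aut) !group_simpl.
by split; [exact: tensor_liftM|exact: tensor_lift_elt].
Qed.

Fact tensor_mu_spec :
  {morph mu : t u / t * u} /\ forall g h, mu (g \ox h) = actG g h * h^-1.
Proof.
have fMl g g' h : actG (g * g') h * h^-1 =
    actG (g * g' * g^-1) (actG g h) * (actG g h)^-1 * (actG g h * h^-1).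
  by rewrite -(actM actG_aut) !group_simpl.
have fMr g h h' : actG g (h * h') * (h * h')^-1 = actG g h * h^-1 *
    (actG (actH h g) (h * h' * h^-1) * (h * h' * h^-1)^-1).
  by rewrite compat_conjG (actD actG_aut) !group_simpl.
by split; [exact: tensor_liftM|exact: tensor_lift_elt].
Qed.

Fact tensor_actG_spec x :
  {morph tG x : t u / t * u} /\
  forall g h, tG x (g \ox h) = (x * g * x^-1) \ox actG x h.
Proof.
have fMl g g' h : (x * (g * g') * x^-1) \ox actG x h =
    (x * (g * g' * g^-1) * x^-1) \ox actG x (actG g h) *
    (x * g * x^-1) \ox actG x h.
  have -> : x * (g * g') * x^-1 = (x * g * x^-1) * (x * g' * x^-1).
    by rewrite !group_simpl.
  rewrite tensorMl -!(actM actG_aut); congr (_ \ox actG _ _ * _);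
  by rewrite !group_simpl.
have fMr g h h' : (x * g * x^-1) \ox actG x (h * h') =
    (x * g * x^-1) \ox actG x h *
    (x * actH h g * x^-1) \ox actG x (h * h' * h^-1).
  by rewrite !(actD actG_aut) tensorMr compat_conjH (actV actG_aut).
by split; [exact: tensor_liftM|exact: tensor_lift_elt].
Qed.

Fact tensor_actH_spec y :
  {morph tH y : t u / t * u} /\
  forall g h, tH y (g \ox h) = actH y g \ox (y * h * y^-1).
Proof.
have fMl g g' h : actH y (g * g') \ox (y * h * y^-1) =
    actH y (g * g' * g^-1) \ox (y * actG g h * y^-1) *
    actH y g \ox (y * h * y^-1).
  by rewrite !(actD actH_aut) tensorMl compat_conjG (actV actH_aut).
have fMr g h h' : actH y g \ox (y * (h * h') * y^-1) =
    actH y g \ox (y * h * y^-1) *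
    actH y (actH h g) \ox (y * (h * h' * h^-1) * y^-1).
  have -> : y * (h * h') * y^-1 = (y * h * y^-1) * (y * h' * y^-1).
    by rewrite !group_simpl.
  rewrite tensorMr -!(actM actH_aut); congr (_ * actH _ _ \ox _);
  by rewrite !group_simpl.
by split; [exact: tensor_liftM|exact: tensor_lift_elt].
Qed.

Lemma lambdaM : {morph lambda : t u / t * u}.
Proof. by case: tensor_lambda_spec. Qed.
Lemma muM : {morph mu : t u / t * u}. Proof. by case: tensor_mu_spec. Qed.
Lemma tGM x : {morph tG x : t u / t * u}.
Proof. by case: (tensor_actG_spec x). Qed.
Lemma tHM y : {morph tH y : t u / t * u}.
Proof. by case: (tensor_actH_spec y). Qed.

Lemma lambda_elt g h : lambda (g \ox h) = g * (actH h g)^-1.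
Proof. by case: tensor_lambda_spec. Qed.
Lemma mu_elt g h : mu (g \ox h) = actG g h * h^-1.
Proof. by case: tensor_mu_spec. Qed.
Lemma tG_elt x g h : tG x (g \ox h) = (x * g * x^-1) \ox actG x h.
Proof. by case: (tensor_actG_spec x). Qed.
Lemma tH_elt y g h : tH y (g \ox h) = actH y g \ox (y * h * y^-1).
Proof. by case: (tensor_actH_spec y). Qed.

Lemma tensorMl_act g g' h : (g * g') \ox h = tG g (g' \ox h) * g \ox h.
Proof. by rewrite tG_elt tensorMl. Qed.

Lemma tensorMr_act g h h' : g \ox (h * h') = g \ox h * tH h (g \ox h').
Proof. by rewrite tH_elt tensorMr. Qed.

Lemma tensor1l h : 1 \ox h = 1.
Proof.
apply: (mulIg (1 \ox h)); rewrite -[X in X \ox _ * _](mulg1 1) mul1g.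
by have := tensorMl 1 1 h; rewrite !group_simpl (act1 actG_aut) => <-.
Qed.

Lemma tensor1r g : g \ox 1 = 1.
Proof.
apply: (mulgI (g \ox 1)).
by have := tensorMr g 1 1; rewrite !group_simpl (act1 actH_aut) => <-.
Qed.

Lemma tensor_ext (K : groupType) (f1 f2 : T -> K) :
  {morph f1 : t u / t * u} -> {morph f2 : t u / t * u} ->
  (forall g h, f1 (g \ox h) = f2 (g \ox h)) -> forall t, f1 t = f2 t.
Proof.
move=> f1M f2M f12; apply: (generates_eq_morph tensor_generates f1M f2M).
by move=> _ [g [h ->]]; exact: f12.
Qed.

Lemma tensor_actG_aut : left_action_by_automorphisms tG.
Proof.
split=> [|x x'|x]; last exact: tGM.
- apply: tensor_ext => [|//|g h]; first exact: tGM.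
  by rewrite tG_elt !group_simpl (act1 actG_aut).
- apply: tensor_ext => [||g h]; first exact: tGM.
    by move=> t u; rewrite !tGM.
  by rewrite !tG_elt (actM actG_aut) !group_simpl.
Qed.

Lemma tensor_actH_aut : left_action_by_automorphisms tH.
Proof.
split=> [|y y'|y]; last exact: tHM.
- apply: tensor_ext => [|//|g h]; first exact: tHM.
  by rewrite tH_elt !group_simpl (act1 actH_aut).
- apply: tensor_ext => [||g h]; first exact: tHM.
    by move=> t u; rewrite !tHM.
  by rewrite !tH_elt (actM actH_aut) !group_simpl.
Qed.

Lemma lambda_tG x t : lambda (tG x t) = x * lambda t * x^-1.
Proof.
move: t; apply: tensor_ext => [||g h].
- by move=> t u; rewrite tGM lambdaM.
- by move=> t u; rewrite lambdaM !group_simpl.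
- by rewrite tG_elt !lambda_elt compat_conjH !group_simpl.
Qed.

(** The actions on [T] inherit the compatibility condition: [actG g h] acts as
    the conjugate of [h] by [g] would in a group containing [G] and [H]. *)
Lemma tH_actG g h t : tH (actG g h) t = tG g (tH h (tG g^-1 t)).
Proof.
move: t; apply: tensor_ext => [||g' h'].
- exact: tHM.
- by move=> t u; rewrite tGM tHM tGM.
rewrite !(tG_elt, tH_elt) compat.2 invgK; congr (_ \ox _).
by rewrite !(actD actG_aut) (actV actG_aut) (actVK actG_aut).
Qed.

Lemma tG_actH g h t : tG (actH h g) t = tH h (tG g (tH h^-1 t)).
Proof.
move: t; apply: tensor_ext => [||g' h'].
- exact: tGM.
- by move=> t u; rewrite tHM tGM tHM.
rewrite !(tG_elt, tH_elt) compat.1 invgK; congr (_ \ox _).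
by rewrite !(actD actH_aut) (actV actH_aut) (actVK actH_aut).
Qed.

(** Expand [(g * g') \ox (h * h')] first on the left or first on the right, and
    cancel the common outer factors. *)
Lemma tensor_swap g h t :
  g \ox h * tH h (tG g t) * (g \ox h)^-1 = tG g (tH h t).
Proof.
move: t; apply: tensor_ext => [||g' h'].
- by move=> t u; rewrite tGM tHM !group_simpl.
- by move=> t u; rewrite tHM tGM.
have : (g * g') \ox (h * h') = (g * g') \ox (h * h') by [].
rewrite {1}tensorMl_act !tensorMr_act tGM.
rewrite -!mulgA tensorMl_act -!mulgA => /mulgI.
rewrite tensorMl_act tHM !mulgA => /mulIg <-.
by rewrite mulgK.
Qed.

(** [tensor_swap] says that conjugation by [g \ox h] is the commutator of the
    actions of [g] and [h], which compatibility rewrites as the action of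
    [mu (g \ox h)], or of [lambda (g \ox h)] below. *)
Lemma tensor_conj_elt_mu g h t :
  g \ox h * t * (g \ox h)^-1 = tH (mu (g \ox h)) t.
Proof.
rewrite mu_elt (actM tensor_actH_aut) tH_actG -tensor_swap.
by rewrite (actVK tensor_actG_aut) (actVK tensor_actH_aut).
Qed.

Lemma tensor_conj_elt_lambda g h t :
  g \ox h * t * (g \ox h)^-1 = tG (lambda (g \ox h)) t.
Proof.
rewrite lambda_elt (actM tensor_actG_aut) -(actV actH_aut) tG_actH -tensor_swap.
by rewrite (actVK tensor_actG_aut) (actVK tensor_actH_aut).
Qed.

Lemma tensor_conj_subgroup (K : groupType) (act : K -> T -> T) (f : T -> K) :
  left_action_by_automorphisms act -> {morph f : t u / t * u} ->
  (forall g h t, g \ox h * t * (g \ox h)^-1 = act (f (g \ox h)) t) ->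
  forall t u, t * u * t^-1 = act (f t) u.
Proof.
move=> act_aut fM eltP; apply: tensor_generates => [|_ [g [h ->]] u]; last first.
  exact: eltP.
split=> /= [u|t t' IHt IHt' u|t IHt u].
- by rewrite (morph_group1 fM) (act1 act_aut) !group_simpl.
- by rewrite fM (actM act_aut) -IHt' -IHt !group_simpl.
- apply: (can_inj (actK act_aut (f t))).
  by rewrite (morph_groupV fM) (actVK act_aut) -IHt !group_simpl.
Qed.

Lemma tensor_conj_mu t u : t * u * t^-1 = tH (mu t) u.
Proof.
exact: (tensor_conj_subgroup tensor_actH_aut muM tensor_conj_elt_mu).
Qed.

Lemma tensor_conj_lambda t u : t * u * t^-1 = tG (lambda t) u.
Proof.
exact: (tensor_conj_subgroup tensor_actG_aut lambdaM tensor_conj_elt_lambda).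
Qed.

(** For [t = g \ox h], put [x = g^-1 * y * g] and expand [(y * g) \ox h] and
    [(g * x) \ox h], two names of one element. The second contains
    [y \ox actG g h], and [actG g h = mu t * h]. *)
Lemma tensor_elt_mu y t : y \ox mu t = tG y t * t^-1.
Proof.
move: t; apply: tensor_generates => [|_ [g [h ->]]]; last first.
  have := tensorMl_act y g h.
  have {1}-> : y * g = g * (g^-1 * y * g) by rewrite !group_simpl.
  rewrite tensorMl -[actG g h](mulgVK h) -mu_elt.
  rewrite tensorMr_act -tensor_conj_mu !group_simpl.
  by move/mulIg => <-; rewrite !group_simpl.
split=> /= [|t u IHt IHu|t IHt].
- by rewrite (morph_group1 muM) tensor1r (act_1 tensor_actG_aut) mulgV.
- by rewrite muM tensorMr_act -tensor_conj_mu IHt IHu tGM !group_simpl.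
- have := tensorMr_act y (mu t) (mu t^-1).
  rewrite -muM mulgV (morph_group1 muM) tensor1r -tensor_conj_mu IHt.
  move/esym/mulg1_eq => inv_eq; apply: (mulgI t); apply: (mulIg t^-1).
  by rewrite -inv_eq (actV tensor_actG_aut) !group_simpl.
Qed.

(** The mirror image of [tensor_elt_mu], from [y * (y^-1 * h * y) = h * y] and
    [g = lambda (g \ox y) * actH y g]. *)
Lemma tensor_elt_lambda t h : lambda t \ox h = t * (tH h t)^-1.
Proof.
move: t; apply: tensor_generates => [|_ [g [y ->]]]; last first.
  have := tensorMr g y (y^-1 * h * y).
  have -> : y * (y^-1 * h * y) = h * y by rewrite !group_simpl.
  rewrite tensorMr_act -{1}[g](mulgVK (actH y g)) -lambda_elt.
  rewrite tensorMl_act -tensor_conj_lambda !group_simpl.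
  rewrite -!mulgA => /mulgI/(canRL (mulKg _)); rewrite mulVg => /mulg1_eq eq_t.
  by apply: (mulIg (tH h (g \ox y))); rewrite mulgVK -eq_t invgK.
split=> /= [|t u IHt IHu|t IHt].
- by rewrite (morph_group1 lambdaM) tensor1l (act_1 tensor_actH_aut) mulgV.
- by rewrite lambdaM tensorMl_act -tensor_conj_lambda IHt IHu tHM !group_simpl.
- have := tensorMl_act (lambda t^-1) (lambda t) h.
  rewrite -lambdaM mulVg (morph_group1 lambdaM) tensor1l -tensor_conj_lambda IHt.
  move/esym/mulg1_eq => <-.
  by rewrite (actV tensor_actH_aut) !group_simpl.
Qed.

(** By [tensor_elt_mu] the group [G] fixes [t], and [lambda] turns the action
    of [G] into conjugation. *)
Lemma center_lambda_ker t : mu t = 1 -> center (lambda t).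
Proof.
move=> mu_t x; have := tensor_elt_mu x t; rewrite mu_t tensor1r.
move/esym/divg1_eq => fix_t.
by rewrite /commute -{1}fix_t lambda_tG mulgVK.
Qed.

(** The subgroup [P] is stable under the action of each [g] with all [g \ox h]
    in [P]: by [tensor_elt_mu] the element [g] sends [t] to
    [(g \ox mu t) * t]. *)
Lemma generates_tensor (A : set G) :
  generates A -> generates [set t : T | exists g h, A g /\ t = g \ox h].
Proof.
move=> genA P subP AP; case: (subP) => P1 PM PV.
have eltP g h : P (g \ox h).
  move: g h; apply: genA => [|g Ag h]; last by apply: AP; exists g, h.
  have tGP g t : (forall h, P (g \ox h)) -> P t -> P (tG g t).
    by move=> gP Pt; rewrite -(mulgVK t (tG g t)) -tensor_elt_mu; exact: PM.
  split=> /= [h|g g' gP gP' h|g gP h]; first by rewrite tensor1l.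
    by rewrite tensorMl_act; apply: PM => //; exact: tGP.
  have := tensorMl_act g g^-1 h; rewrite mulgV tensor1l.
  rewrite -(mulgVK (g^-1 \ox h) (tG g _)) -tensor_elt_mu -mulgA.
  move/esym/mulg1_eq => inv_eq.
  by rewrite -(mulgK (g \ox h) (g^-1 \ox h)) -inv_eq; apply: PM; exact: PV.
by apply: (tensor_generates subP) => _ [g [h ->]]; exact: eltP.
Qed.

End TensorProduct.

(** * Semidirect products *)

Section Semidirect.
Variables (N Q : groupType) (act : Q -> N -> N).
Hypothesis act_aut : left_action_by_automorphisms act.

(** The proof that [act] is an action is a parameter of the type, so that the
    group laws are found by inference on it; it also keeps the type apart from
    the direct product. *)
Definition semidirect_of (_ : left_action_by_automorphisms act) : Type :=
  (N * Q)%type.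

Local Notation E := (semidirect_of act_aut).

HB.instance Definition _ := Choice.copy E (N * Q)%type.

Definition semidirect_mul (x y : E) : E := (x.1 * act x.2 y.1, x.2 * y.2).
Definition semidirect_one : E := (1, 1).
Definition semidirect_inv (x : E) : E := (act x.2^-1 x.1^-1, x.2^-1).

Fact semidirect_mulA : associative semidirect_mul.
Proof.
move=> x y z; rewrite /semidirect_mul /=.
by rewrite (actD act_aut) (actM act_aut) !mulgA.
Qed.

Fact semidirect_mul1 : left_id semidirect_one semidirect_mul.
Proof. by case=> t h; rewrite /semidirect_mul /= (act1 act_aut) !mul1g. Qed.

Fact semidirect_mulr1 : right_id semidirect_one semidirect_mul.
Proof. by case=> t h; rewrite /semidirect_mul /= (act_1 act_aut) !mulg1. Qed.

Fact semidirect_mulV :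
  left_inverse semidirect_one semidirect_inv semidirect_mul.
Proof.
case=> t h; rewrite /semidirect_mul /= -(actD act_aut) !mulVg.
by rewrite (act_1 act_aut).
Qed.

Fact semidirect_mulrV :
  right_inverse semidirect_one semidirect_inv semidirect_mul.
Proof. by case=> t h; rewrite /semidirect_mul /= (actVK act_aut) !mulgV. Qed.

HB.instance Definition _ := isGroup.Build E semidirect_mulA semidirect_mul1
  semidirect_mulr1 semidirect_mulV semidirect_mulrV.

Lemma semidirectM (n n' : N) (q q' : Q) :
  ((n, q) : E) * (n', q') = (n * act q n', q * q').
Proof. by []. Qed.

End Semidirect.

(** * Finiteness of the tensor product *)

Section Finiteness.
Variables (G : groupType) (H : finGroupType).
Variables (actG : G -> H -> H) (actH : H -> G -> G).
Hypotheses (actG_aut : left_action_by_automorphisms actG)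
  (actH_aut : left_action_by_automorphisms actH)
  (compat : compatible_actions actG actH).
Hypotheses (fgG : finitely_generated G) (finZ : finite_set (@center G)).

Local Notation T := (tensor actG actH).
Local Notation "g \ox h" := (tensor_elt actG actH g h) (at level 39).
Local Notation lambda := (@tensor_lambda G H actG actH).
Local Notation mu := (@tensor_mu G H actG actH).
Local Notation tH := (@tensor_actH G H actG actH).
Let tH_aut := tensor_actH_aut actH_aut compat.
Local Notation E := (semidirect_of tH_aut).

(** If [s h] is a preimage of [h] under [mu], then [t * (s (mu t))^-1] is in the
    kernel of [mu], so [lambda t] is a central element times
    [lambda (s (mu t))]. *)
Lemma finite_range_lambda : finite_set (range lambda).
Proof.
have lambdaM := lambdaM actH_aut compat.
have muM := muM actG_aut compat.
have /choice[s sP] (h : H) : exists t0, forall t, mu t = h -> mu t0 = h.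
  have [[t mu_t]|none] := pselect (exists t, mu t = h); first by exists t.
  by exists 1 => t mu_t; case: none; exists t.
apply: sub_finite_set (finite_image2 (fun c h => c * lambda (s h)) finZ
  (@finite_finset _ [set: H])) => _ [t _ <-].
exists (lambda (t * (s (mu t))^-1)); last first.
  by exists (mu t); rewrite // -lambdaM mulgVK.
apply: center_lambda_ker => //.
by rewrite muM (morph_groupV muM) (sP _ t) // mulgV.
Qed.

(** [tensorMr_act] is the multiplication rule of the semidirect product. *)
Lemma semidirect_elt_exp (g : G) (h : H) n :
  ((g \ox h, h) : E) ^+ n = (g \ox (h ^+ n), h ^+ n).
Proof.
elim: n => [|n IHn]; first by rewrite !expg0 tensor1r.
by rewrite !expgS IHn semidirectM tensorMr_act.
Qed.

Lemma semidirect_elt_exp_card (g : G) (h : H) :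
  ((g \ox h, h) : E) ^+ #|H| = 1.
Proof.
have hn : h ^+ #|H| = 1 by rewrite -cardsT expg_cardG ?inE.
by rewrite semidirect_elt_exp hn tensor1r.
Qed.

(** Split the first component as [(t * tH h u * t^-1) * (t * (tH k' t)^-1)] with
    [k' = h * k * h^-1]; the factors are [tH (mu t) (tH h u)] and
    [lambda t \ox k']. *)
Lemma semidirect_conj (t u : T) (h k : H) :
  ((u, k) : E) ^ ((t, h) : E)^-1 =
  (tH (mu t) (tH h u) * lambda t \ox (h * k * h^-1), h * k * h^-1).
Proof.
have lambdaM := lambdaM actH_aut compat.
have -> : ((u, k) : E) ^ ((t, h) : E)^-1 =
    (t * tH h u * tH (h * k) (tH h^-1 t^-1), h * k * h^-1).
  by rewrite conjgE invgK mulgA.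
congr (_, _); rewrite tensor_elt_lambda // -tensor_conj_mu //.
rewrite -(actM tH_aut) (actV tH_aut).
by rewrite !group_simpl.
Qed.

Lemma finite_tensor : finite_set [set: T].
Proof.
have /finitely_generatedP[X finX genX] := fgG.
pose B : set E := [set ((g \ox h, h) : E) | g in X & h in [set: H]] `|`
                  range (fun h => (1, h) : E).
pose A : set E := [set y ^ e | y in B & e in [set: E]].
have finB : finite_set B.
  rewrite finite_setU; split; last by apply: finite_image; exact: finite_finset.
  by apply: finite_image2 => //; exact: finite_finset.
have genB : generates B.
  move=> P subP BP; case: (subP) => P1 PM PV.
  have Ph h : P (1, h) by apply: BP; right; exists h.
  have Pt t : P (t, 1).
    apply: (generates_tensor _ _ _ genX (P := [set t | P (t, 1)])) => //.
      apply: (is_subgroup_preimage (f := fun t => (t, 1) : E)) subP => u v.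
      by rewrite semidirectM (act1 tH_aut) mulg1.
    move=> _ [g [h [Xg ->]]] /=.
    have -> : (g \ox h, 1) = ((g \ox h, h) : E) * (1, h^-1).
      by rewrite semidirectM (act_1 tH_aut) mulg1 mulgV.
    by apply: PM => //; apply: BP; left; exists g => //; exists h.
  case=> t h; have -> : (t, h) = ((t, 1) : E) * (1, h).
    by rewrite semidirectM (act1 tH_aut) mulg1 mul1g.
  exact: PM.
have genA : generates A.
  move=> P subP AP; apply: (genB _ subP) => y By; apply: AP.
  by exists y => //; exists 1; rewrite ?conjg1.
have expA x : A x -> x ^+ #|H| = 1.
  case=> y By [e _ <-]; rewrite -conjXg.
  suff -> : y ^+ #|H| = 1 by rewrite conj1g.
  case: By => [[g _ [h _ <-]]|[h _ <-]]; first exact: semidirect_elt_exp_card.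
  (* Here (1, h) is (1 \ox h, h). *)
  by rewrite -(tensor1l actH actG_aut h) semidirect_elt_exp_card.
have conjA x y : A x -> A y -> A (x ^ y).
  by case=> z Bz [e _ <-] _; exists z => //; exists (e * y); rewrite ?conjgM.
(* The arguments z.1, z.2.1 and z.2.2 stand for lambda t, mu t and h. *)
pose f (y : E) (z : G * (H * H)) : E := let k := z.2.2 * y.2 * z.2.2^-1 in
  (tH z.2.1 (tH z.2.2 y.1) * z.1 \ox k, k).
have finA : finite_set A.
  have finR : finite_set (range lambda `*` [set: H * H]).
    by apply: finite_setX; [exact: finite_range_lambda|exact: finite_finset].
  apply: sub_finite_set (finite_image2 f finB finR).
  move=> _ [[u k] Buk [e _ <-]]; exists (u, k) => //.
  rewrite -[e]invgK; case: e^-1 => t h.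
  exists (lambda t, (mu t, h)); last by rewrite semidirect_conj.
  by split=> //; exists t.
have n_gt0 : 0 < #|H| by apply/card_gt0P; exists 1.
have finE := finite_dietzmann finA n_gt0 conjA expA genA.
have := finite_image (fun x : E => x.1) finE; congr finite_set.
by apply/seteqP; split=> // t _; exists (t, 1).
Qed.

End Finiteness.

Local Open Scope classical_set_scope.

Theorem theorem4p6 (G : groupType) (H : finGroupType)
    (actG : G -> H -> H) (actH : H -> G -> G)
    (actG_aut : left_action_by_automorphisms actG)
    (actH_aut : left_action_by_automorphisms actH)
    (compatible : compatible_actions actG actH)
    (GC : class_C G) :
  finite_set [set: tensor actG actH].
Proof.
apply: finite_tensor => //; first exact: class_C_finitely_generated.
exact: class_C_finite_center.
Qed.
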